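(* Let $\pi$, $\lambda$ and $\eta$ be as in the context. Assume that $\overline{\lambda}$ is dominatedly varying. Then $\overline{\eta}$ is dominatedly varying, and $$\limsup_{r\to\infty}\frac{\overline{\lambda}(r)}{\overline{\eta}(r)}<\infty.$$ Furthermore, if for some $c>1$ $$\limsup_{r\to\infty}\frac{\overline{\lambda}(cr)}{\overline{\lambda}(r)}<1,$$ then $$\limsup_{r\to\infty}\frac{\overline{\eta}(r)}{\overline{\lambda}(r)}<\infty.$$
   Context: For a measure $Q$ on $(0,\infty)$ write $m_p(Q)=\int_{(0,\infty)}x^p\,Q(\mathrm{d}x)$ and $\overline{Q}(x)=Q((x,\infty))$ for $x>0$. Setting: $\pi$ is a nonzero measure on $(0,\infty)$ with $m_{-1}(\pi)=\int_{(0,\infty)}x^{-1}\pi(\mathrm{d}x)<\infty$. $\lambda$ is a Lévy measure on $(0,\infty)$, i.e. $\int_{(0,\infty)}(1\wedge z^2)\lambda(\mathrm{d}z)<\infty$, satisfying $\int_{(1,\infty)}\log z\,\lambda(\mathrm{d}z)<\infty$. The measure $\eta$ on $(0,\infty)$ (the Lévy measure of the marginal law of the supOU process with characteristics $\pi,\lambda$) is $$\eta(B)=m_{-1}(\pi)\,(\mathrm{Leb}\times\lambda)\big(\{(u,z):u>0,\ z>0,\ e^{-u}z\in B\}\big),$$ for Borel $B\subset(0,\infty)$; in particular $\overline{\eta}(r)=m_{-1}(\pi)\int_r^\infty \overline{\lambda}(z)z^{-1}\,\mathrm{d}z$. A nonincreasing (never vanishing) function $h$ on $(0,\infty)$ is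 dominatedly varying if $\limsup_{x\to\infty}h(x)/h(2x)<\infty$. *)

(* Defs.v *)
From HB Require Import structures.
From mathcomp Require Import all_boot all_order all_algebra.
From mathcomp Require Import all_classical all_reals all_analysis.
Set Implicit Arguments.
Unset Strict Implicit.
Unset Printing Implicit Defensive.
Import Order.TTheory GRing.Theory Num.Theory.
Import numFieldNormedType.Exports.

Local Open Scope classical_set_scope.
Local Open Scope ring_scope.
Local Open Scope ereal_scope.

(* A measure on (0, oo) is encoded as a Borel measure on R that does not charge
   the complement of (0, oo). *)
Definition on_pos (R : realType)
    (Q : {measure set (measurableTypeR R) -> \bar R}) : Prop :=
  Q (~` `]0%R, +oo[%classic) = 0.

Definition moment (R : realType) (p : R)
    (Q : {measure set (measurableTypeR R) -> \bar R}) : \bar R :=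
  \int[Q]_(x in `]0%R, +oo[) (x `^ p)%:E.

Definition tail (R : realType) (Q : set R -> \bar R) (x : R) : \bar R :=
  Q `]x, +oo[%classic.

Definition levy_measure (R : realType)
    (Q : {measure set (measurableTypeR R) -> \bar R}) : Prop :=
  on_pos Q /\ \int[Q]_(z in `]0%R, +oo[) (Num.min 1 (z ^+ 2))%:E < +oo.

(* The constraints 0 < u, 0 < z are part of the set, so supOU_levy pi lambda
   only sees the trace of B on (0, oo). The product [\x] integrates the
   lambda-measure of the u-sections against Lebesgue measure; it is the product
   measure as soon as lambda is sigma-finite, which is the case for Levy
   measures in the sense above. *)
Definition supOU_levy (R : realType)
    (pi lambda : {measure set (measurableTypeR R) -> \bar R})
    (B : set R) : \bar R :=
  moment (-1) pi *
  (@lebesgue_measure R \x lambda)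
    [set uz | [/\ (0 < uz.1)%R, (0 < uz.2)%R & B (expR (- uz.1) * uz.2)%R]].

Definition limsup_pinfty (R : realType) (f : R -> \bar R) : \bar R :=
  limf_esup f (pinfty_nbhs R).

(* Values are taken in \bar R because h will be a tail x |-> Q (x, oo); the
   first clause says that h is a real-valued function on (0, oo). Division is
   that of \bar R, which by the first two clauses only involves nonzero
   denominators and finite arguments near +oo. *)
Definition dominatedly_varying (R : realType) (h : R -> \bar R) : Prop :=
  [/\ forall x : R, (0 < x)%R -> h x \is a fin_num,
      forall x : R, (0 < x)%R -> h x != 0,
      forall x y : R, (0 < x)%R -> (x <= y)%R -> h y <= h x &
      limsup_pinfty (fun x => h x / h (2 * x)%R) < +oo].

(* Main.v *)
Require Import Defs.
From HB Require Import structures.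
From mathcomp Require Import all_boot all_order all_algebra.
From mathcomp Require Import all_classical all_reals all_analysis.
From mathcomp Require Import measurable_realfun ring lra.

(** Write L for the tail of lambda, m for the moment of order -1 of pi, a number
    in (0, oo), and G r for the integral of L (r e^u) over u > 0
    ([log_tail]). Sectioning the set that defines eta at fixed u gives
    tail eta r = m G r ([tail_supOU_levy]), so it is enough to compare L and G.

    The integral G has a second expression: by Tonelli, G r is the
    lambda-integral of ln (z / r) over z > r ([log_tail_ln]). Each expression
    makes one type of estimate immediate.
    - The first is monotone in L: an inequality L (a x) <= K L (b x) for all
      x > 1 gives G a <= K G b ([log_tail_le_scale]). Hence G is nonincreasing
      and inherits from L the bound L r <= C L (2 r) of dominated variation.
    - The second one gives, for c >= 1, the two bounds
      ln c * L (c r) <= G r <= ln c * L r + G (c r)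
      ([log_tail_ge_dilated_tail], [log_tail_le_tail_add]), and the finiteness
      of G from the logarithmic moment condition ([log_tail_lty]).

    The lower bound with c = 2 and dominated variation bound L by a multiple of
    G. If moreover L (c r) <= q L r for large r with q < 1, then
    G (c r) <= q G r, and the upper bound becomes G r <= ln c * L r + q G r,
    that is G r <= ln c / (1 - q) * L r. *)

Set Implicit Arguments.
Unset Strict Implicit.
Unset Printing Implicit Defensive.
Import Order.TTheory GRing.Theory Num.Theory.
Import numFieldNormedType.Exports.

Local Open Scope classical_set_scope.
Local Open Scope ring_scope.
Local Open Scope ereal_scope.

(** * The logarithmic tail integral *)

(** With the substitution z = r e^u this is the integral of tail Q z / z over
    z > r; the exponential form is the one delivered by the sections of the
    product measure in [supOU_levy]. *)
Definition log_tail (R : realType) (Q : set R -> \bar R) (r : R) : \bar R :=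
  \int[@lebesgue_measure R]_(u in `]0%R, +oo[) tail Q (r * expR u)%R.

(** The part of the quadrant 0 < u, 0 < z that the map (u, z) |-> e^-u z sends
    beyond r; for r > 0 the positivity of z is automatic. *)
Definition exp_ray (R : realType) (r : R) : set (R * R) :=
  [set uz | (0 < uz.1)%R /\ (r < expR (- uz.1) * uz.2)%R].

Lemma measurable_exp_ray (R : realType) (r : R) :
  measurable (exp_ray r : set (measurableTypeR R * measurableTypeR R)).
Proof.
rewrite (_ : exp_ray r = fst @^-1` `]0%R, +oo[%classic `&`
    (fun uz => (expR (- uz.1) * uz.2)%R) @^-1` `]r, +oo[%classic); last first.
  by apply/seteqP; split=> -[u z] /=; rewrite /exp_ray /= !in_itv /= !andbT.
apply: measurableI; rewrite -[X in measurable X]setTI.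
  exact: measurable_fst.
have mf : measurable_fun [set: measurableTypeR R * measurableTypeR R]
    (fun uz => (expR (- uz.1) * uz.2)%R : measurableTypeR R).
  apply: measurable_funM; last exact: measurable_snd.
  apply: (measurableT_comp (@measurable_expR R)).
  exact: measurable_funN measurable_fst.
exact: mf.
Qed.

Lemma xsection_exp_ray (R : realType) (r u : R) : (0 < u)%R ->
  xsection (exp_ray r) u = `](r * expR u)%R, +oo[%classic.
Proof.
move=> u0; apply/seteqP; split=> z /=.
  rewrite /xsection /= inE => -[_ /=].
  by rewrite expRN mulrC ltr_pdivlMr ?expR_gt0// in_itv /= andbT.
rewrite in_itv /= andbT /xsection /= inE /exp_ray /= => h; split=> //.
by rewrite expRN mulrC ltr_pdivlMr ?expR_gt0.
Qed.

(** Stated for a bare set function F because it is used both for a measure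
    that is not known to be sigma-finite and for its finite restriction. *)
Lemma integral_xsection_exp_ray (R : realType) (F : set R -> \bar R) (r : R) :
  F set0 = 0 ->
  \int[@lebesgue_measure R]_u F (xsection (exp_ray r) u) =
  \int[@lebesgue_measure R]_(u in `]0%R, +oo[) tail F (r * expR u)%R.
Proof.
move=> F0; rewrite [RHS]integral_mkcond; apply: eq_integral => u _.
rewrite patchE; case: ifPn => [|].
  by rewrite inE /= in_itv /= andbT => u0; rewrite xsection_exp_ray.
rewrite notin_setE /= in_itv /= andbT => /negP u0.
rewrite (_ : xsection _ u = set0)//.
apply/seteqP; split=> // z; rewrite /xsection /= inE => -[/= h _].
by rewrite h in u0.
Qed.

Lemma ysection_exp_ray (R : realType) (r z : R) : (0 < r)%R -> (r < z)%R ->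
  ysection (exp_ray r) z = `]0%R, ln (z / r)[%classic.
Proof.
move=> r0 rz; have z0 := lt_trans r0 rz.
have zr0 : (z / r)%R \is Num.pos by rewrite posrE divr_gt0.
have E u : (r < expR (- u) * z)%R = (u < ln (z / r))%R.
  rewrite -[RHS]ltr_expR lnK// ltr_pdivlMr// expRN mulrC ltr_pdivlMr ?expR_gt0//.
  by rewrite mulrC.
by apply/seteqP; split=> u; rewrite /ysection /= inE /exp_ray /= in_itv /= E;
  [move=> [-> ->]|move=> /andP[]].
Qed.

Section logarithmic_tail.
Context (R : realType) (Q : {measure set (measurableTypeR R) -> \bar R}).
Local Notation G := (log_tail Q).

Lemma tail_ge0 (x : R) : 0 <= tail Q x. Proof. exact: measure_ge0. Qed.

Lemma log_tail_ge0 (r : R) : 0 <= G r.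
Proof. by apply: integral_ge0 => u _; exact: tail_ge0. Qed.

(** Tonelli's theorem and the measurability of sections need a sigma-finite
    measure. All sections of [exp_ray r] lie in (r, oo), so Q may be replaced by
    its restriction to that ray, which is a finite measure. *)
Let fin_restr (r : R) (fr : tail Q r < +oo) :
    {sigma_finite_measure set (measurableTypeR R) -> \bar R} :=
  @mfrestr _ (measurableTypeR R) R `]r, +oo[%classic Q (measurable_itv `]r, +oo[) fr.

Let restr_tail (r : R) (fr : tail Q r < +oo) (u : R) : (0 < r)%R -> (0 < u)%R ->
  fin_restr fr (xsection (exp_ray r) u) = tail Q (r * expR u)%R.
Proof.
move=> r0 u0; rewrite xsection_exp_ray//= /mfrestr /mrestr /tail; congr (Q _).
apply: setIidl => z /=; rewrite !in_itv /= !andbT; apply: le_lt_trans.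
by rewrite ler_peMr// ?(ltW r0)// -expR0 ler_expR ltW.
Qed.

Lemma measurable_tail_exp (r : R) : (0 < r)%R -> tail Q r < +oo ->
  measurable_fun (`]0%R, +oo[%classic : set (measurableTypeR R))
    (fun u => tail Q (r * expR u)%R).
Proof.
move=> r0 fr.
apply: (@eq_measurable_fun _ _ _ _ _ (fin_restr fr \o xsection (exp_ray r))).
  by move=> u; rewrite inE /= in_itv /= andbT => u0; rewrite restr_tail.
apply: measurable_funTS; apply: measurable_fun_xsection.
exact: measurable_exp_ray.
Qed.

(** Exchanging the order of integration: for fixed z > r, the condition
    r e^u < z describes an interval of u of length ln (z / r). This form turns
    the estimates below that compare different values of r into pointwise
    inequalities between logarithms. *)
Lemma log_tail_ln (r : R) : (0 < r)%R -> tail Q r < +oo ->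
  G r = \int[Q]_(z in `]r, +oo[) (ln (z / r))%:E.
Proof.
move=> r0 fr; have mA := measurable_exp_ray r.
have := indic_fubini_tonelli (@lebesgue_measure R) (fin_restr fr) mA.
rewrite indic_fubini_tonelli_FE// indic_fubini_tonelli_GE// => FG.
transitivity (\int[@lebesgue_measure R]_u fin_restr fr (xsection (exp_ray r) u)).
  rewrite integral_xsection_exp_ray ?measure0//; apply: eq_integral => u.
  rewrite inE /= in_itv /= andbT => u0.
  by rewrite -restr_tail// xsection_exp_ray.
rewrite [LHS]FG [RHS](eq_measure_integral (fin_restr fr)); last first.
  by move=> B mB sB; rewrite /= /mfrestr /mrestr setIidl.
rewrite [RHS]integral_mkcond; apply: eq_integral => z _.
rewrite patchE; case: ifPn => [|].
  rewrite inE /= in_itv /= andbT => rz.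
  rewrite ysection_exp_ray// lebesgue_measure_itv /= lte_fin.
  by rewrite ln_gt0 ?ltr_pdivlMr ?mul1r// oppr0 adde0.
rewrite notin_setE /= in_itv /= andbT => /negP; rewrite -leNgt => zr.
rewrite /= (_ : ysection _ z = set0) ?measure0//.
apply/seteqP; split=> // u; rewrite /ysection /= inE => -[/= u0].
apply/negP; rewrite -leNgt expRN mulrC ler_pdivrMr ?expR_gt0//.
by rewrite (le_trans zr)// ler_peMr// ?(ltW r0)// -expR0 ler_expR ltW.
Qed.

Let measurable_ln_ratio (D : set (measurableTypeR R)) (r : R) :
  measurable_fun D (fun z => (ln (z / r))%:E).
Proof.
apply: measurable_funTS; apply/measurable_EFinP.
exact: (measurableT_comp (@measurable_ln R) (measurable_funM _ _)).
Qed.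

(** For z > c r the integrand ln (z / r) is at least ln c. *)
Lemma log_tail_ge_dilated_tail (c r : R) : (1 <= c)%R -> (0 < r)%R -> tail Q r < +oo ->
  (ln c)%:E * tail Q (c * r)%R <= G r.
Proof.
move=> c1 r0 fr; rewrite log_tail_ln//.
have sub : `](c * r)%R, +oo[%classic `<=` `]r, +oo[%classic.
  move=> z /=; rewrite !in_itv /= !andbT; apply: le_lt_trans.
  by rewrite ler_peMl// ltW.
apply: (@le_trans _ _ (\int[Q]_(z in `](c * r)%R, +oo[) (ln (z / r))%:E)).
  rewrite -integral_cst//; apply: ge0_le_integral => //.
  - by move=> z _; rewrite lee_fin ln_ge0.
  - move=> z /=; rewrite in_itv /= andbT => h; rewrite lee_fin.
    have c0 : (0 < c)%R by rewrite (lt_le_trans ltr01).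
    have z0 : (0 < z)%R by rewrite (lt_trans _ h)// mulr_gt0.
    by rewrite ler_ln ?posrE ?divr_gt0// ler_pdivlMr// ltW.
apply: ge0_subset_integral => // z /=; rewrite in_itv /= andbT => rz.
by rewrite lee_fin ln_ge0// ler_pdivlMr// mul1r ltW.
Qed.

(** Pointwise, ln (z / r) = ln c + ln (z / (c r)) when z > c r, and
    ln (z / r) <= ln c when r < z <= c r. *)
Lemma log_tail_le_tail_add (c r : R) : (1 <= c)%R -> (0 < r)%R -> tail Q r < +oo ->
  G r <= (ln c)%:E * tail Q r + G (c * r)%R.
Proof.
move=> c1 r0 fr; have c0 : (0 < c)%R by rewrite (lt_le_trans ltr01).
have cr0 : (0 < c * r)%R by rewrite mulr_gt0.
have sub : `](c * r)%R, +oo[%classic `<=` `]r, +oo[%classic.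
  move=> z /=; rewrite !in_itv /= !andbT; apply: le_lt_trans.
  by rewrite ler_peMl// ltW.
have fcr : tail Q (c * r)%R < +oo.
  by apply: le_lt_trans fr; rewrite /tail le_measure ?inE.
rewrite !log_tail_ln// -integral_cst//.
rewrite -(setIidr sub) integral_mkcondr -ge0_integralD//; last 2 first.
- move=> z _; rewrite patchE; case: ifPn => //; rewrite inE /= in_itv /= andbT.
  by move=> h; rewrite lee_fin ln_ge0// ler_pdivlMr// mul1r ltW.
- by apply: measurable_funTS; apply/(measurable_restrictT _ _).1.
apply: ge0_le_integral => //.
- move=> z /=; rewrite in_itv /= andbT => rz.
  by rewrite lee_fin ln_ge0// ler_pdivlMr// mul1r ltW.
- apply: emeasurable_funD => //.
  by apply: measurable_funTS; apply/(measurable_restrictT _ _).1.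
- move=> z /=; rewrite in_itv /= andbT => rz; have z0 := lt_trans r0 rz.
  rewrite patchE; case: ifPn => h.
    rewrite -EFinD lee_fin -lnM ?posrE ?divr_gt0//.
    suff -> : (c * (z / (c * r)) = z / r)%R by [].
    by field; rewrite !gt_eqF.
  move: h; rewrite notin_setE /= in_itv /= andbT => /negP; rewrite -leNgt => zcr.
  by rewrite adde0 lee_fin ler_ln ?posrE ?divr_gt0// ler_pdivrMr.
by move=> z _; rewrite lee_fin ln_ge0.
Qed.

(** At r >= 1 the integral of ln (z / r) over (r, oo) is at most that of ln z
    over (1, oo); a smaller r is brought to 1 by [log_tail_le_tail_add] with
    the dilation c = 1 / r. *)
Lemma log_tail_lty (r : R) : (forall x : R, (0 < x)%R -> tail Q x < +oo) ->
  \int[Q]_(z in `]1%R, +oo[) (ln z)%:E < +oo -> (0 < r)%R -> G r < +oo.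
Proof.
move=> fQ logQ r0.
have G1 : G 1%R < +oo.
  rewrite log_tail_ln ?fQ//; apply: le_lt_trans logQ.
  by under eq_integral do rewrite divr1.
case: (leP r 1%R) => r1.
  have c1 : (1 <= r^-1)%R by rewrite invf_ge1.
  apply: (le_lt_trans (log_tail_le_tail_add c1 r0 (fQ _ r0))).
  rewrite mulVf ?gt_eqF//; apply: lte_add_pinfty G1.
  by apply: lte_mul_pinfty => //; [rewrite lee_fin ln_ge0|exact: fQ].
apply: le_lt_trans G1; rewrite !log_tail_ln ?fQ//.
apply: (@le_trans _ _ (\int[Q]_(z in `]r, +oo[) (ln (z / 1))%:E)).
  apply: ge0_le_integral => //.
    move=> z /=; rewrite in_itv /= andbT => rz.
    by rewrite lee_fin ln_ge0// ler_pdivlMr// mul1r ltW.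
  move=> z /=; rewrite in_itv /= andbT => rz; have z0 := lt_trans r0 rz.
  rewrite lee_fin ler_ln ?posrE ?divr_gt0//.
  by rewrite ler_pM2l// lef_pV2 ?posrE// ltW.
apply: ge0_subset_integral => //.
  move=> z /=; rewrite in_itv /= andbT => z1.
  by rewrite lee_fin ln_ge0// divr1 ltW.
by move=> z /=; rewrite !in_itv /= !andbT; exact: lt_trans.
Qed.

(** A comparison of the tail along the two rays (a, oo) and (b, oo) passes
    through the integral over u, with x = e^u. *)
Lemma log_tail_le_scale (a b K : R) : (0 < a)%R -> (0 < b)%R -> (0 <= K)%R ->
  tail Q a < +oo -> tail Q b < +oo ->
  (forall x : R, (1 < x)%R -> tail Q (a * x)%R <= K%:E * tail Q (b * x)%R) ->
  G a <= K%:E * G b.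
Proof.
move=> a0 b0 K0 fa fb ab; rewrite /log_tail -ge0_integralZl//; last first.
  exact: measurable_tail_exp.
apply: ge0_le_integral => //.
- exact: measurable_tail_exp.
- by apply: measurable_funeM; exact: measurable_tail_exp.
- move=> u /=; rewrite in_itv /= andbT => u0; apply: ab.
  by rewrite -expR0 ltr_expR.
Qed.
End logarithmic_tail.

(** * Asymptotic bounds and upper limits of quotients *)

(** Replacing the value of the supremum by its maximum with 0 makes the bound q
    finite and nonnegative, even if f / g is unbounded below. *)
Lemma limsup_ratio_bound (R : realType) (f g : R -> \bar R) (b : \bar R) :
  0 < b -> (forall x : R, (0 < x)%R -> g x \is a fin_num /\ 0 < g x) ->
  limsup_pinfty (fun x => f x / g x) < b ->
  exists q M : R, [/\ (0 <= q)%R, q%:E < b, (0 < M)%R &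
    forall x : R, (M < x)%R -> f x <= q%:E * g x].
Proof.
move=> b0 g0 /ereal_inf_lt[_ [V [M [_ MV]] <-]] supb.
pose s := ereal_sup [set f x / g x | x in V].
have sb : Order.max 0 s < b by rewrite gt_max b0.
have sf : Order.max 0 s \is a fin_num.
  by rewrite ge0_fin_numE ?(lt_le_trans sb) ?leey// le_max lexx.
(* The threshold is at least 1 so that g is controlled beyond it. *)
exists (fine (Order.max 0 s)), (Num.max 1 M)%R; split.
- by rewrite fine_ge0// le_max lexx.
- by rewrite fineK.
- by rewrite lt_max ltr01.
move=> x; rewrite gt_max => /andP[x1 Mx].
have [gf gp] := g0 x (lt_trans ltr01 x1).
rewrite fineK//; move: gp; rewrite -(fineK gf) lte_fin => gp.
rewrite -lee_pdivrMr//; apply: (@le_trans _ _ s); last by rewrite le_max lexx orbT.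
apply: ereal_sup_ubound; exists x; first exact: MV.
by rewrite -[in LHS](fineK gf) inver gt_eqF.
Qed.

Lemma limsup_ratio_lty (R : realType) (f g : R -> \bar R) (K M : R) :
  (0 < M)%R -> (forall x : R, (0 < x)%R -> g x \is a fin_num /\ 0 < g x) ->
  (forall x : R, (M < x)%R -> f x <= K%:E * g x) ->
  limsup_pinfty (fun x => f x / g x) < +oo.
Proof.
move=> M0 g0 fg; apply: (@le_lt_trans _ _ K%:E); last exact: ltry.
apply: (@le_trans _ _ (ereal_sup [set f x / g x | x in [set x | (M < x)%R]])).
  apply: ereal_inf_lbound; exists [set x | (M < x)%R] => //.
  by exists M; split=> //; exact: num_real.
apply: ge_ereal_sup => _ [x /= Mx <-].
have [gf gp] := g0 x (lt_trans M0 Mx); have := fg x Mx.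
move: gp; rewrite -(fineK gf) lte_fin => gp.
by rewrite inver gt_eqF// lee_pdivrMr.
Qed.

(** * The tail of the supOU Levy measure *)

(** A zero integral would force x^p = 0 for Q-almost every x > 0, whereas x^p
    never vanishes there. *)
Lemma moment_gt0 (R : realType) (p : R)
    (Q : {measure set (measurableTypeR R) -> \bar R}) :
  Q `]0%R, +oo[%classic != 0 -> 0 < moment p Q.
Proof.
move=> Q0; have m0 : 0 <= moment p Q.
  by apply: integral_ge0 => x _; rewrite lee_fin powR_ge0.
rewrite lt_neqAle m0 andbT; apply: contra Q0 => /eqP m0'.
have mf : measurable_fun (`]0%R, +oo[%classic : set (measurableTypeR R))
    (fun x => (x `^ p)%:E).
  by apply: measurable_funTS; apply/measurable_EFinP; exact: measurable_powR.
have : \int[Q]_(x in `]0%R, +oo[) `|(x `^ p)%:E| = 0.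
  by rewrite m0'; apply: eq_integral => x _; rewrite gee0_abs// lee_fin powR_ge0.
move=> /ae_eq_integral_abs => /(_ (measurable_itv _) mf) [N [mN N0 sub]].
rewrite -measure_le0 -N0 le_measure ?inE//.
apply: subset_trans sub => x /= x0 /(_ x0).
by move: x0; rewrite in_itv /= andbT => x0 [] /eqP; rewrite gt_eqF// powR_gt0.
Qed.

Lemma tail_supOU_levy (R : realType)
    (pi lambda : {measure set (measurableTypeR R) -> \bar R}) (r : R) :
  (0 < r)%R ->
  tail (supOU_levy pi lambda) r = moment (-1) pi * log_tail lambda r.
Proof.
move=> r0; rewrite /tail /supOU_levy; congr (_ * _).
rewrite (_ : [set _ | _] = exp_ray r); last first.
  apply/seteqP; split=> -[u z] /=; rewrite in_itv /= andbT; first by case.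
  move=> [/= u0 h]; split=> //.
  by have := lt_trans r0 h; rewrite pmulr_rgt0 ?expR_gt0.
by rewrite /product_measure1 integral_xsection_exp_ray ?measure0.
Qed.

(** * Comparison of the tail with its logarithmic integral *)

(** Only (r, 2 r) matters: the tail is at least tail Q (2 r) on that interval,
    which has logarithmic length ln 2, and the domination compares
    tail Q (2 r) with tail Q r. *)
Lemma tail_le_log_tail (R : realType)
    (Q : {measure set (measurableTypeR R) -> \bar R}) (C r : R) :
  (0 < r)%R -> (0 <= C)%R -> tail Q r < +oo ->
  tail Q r <= C%:E * tail Q (2 * r)%R ->
  tail Q r <= (C / ln 2)%:E * log_tail Q r.
Proof.
move=> r0 C0 fr dom; apply: (le_trans dom).
have l2 : (0 < ln 2 :> R)%R by rewrite ln_gt0// ltr1n.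
rewrite EFinM -muleA; apply: lee_wpmul2l; first by rewrite lee_fin.
by rewrite lee_pdivlMl// log_tail_ge_dilated_tail// ler1n.
Qed.

(** The decay of the tail makes the dilation r |-> c r a contraction of the
    integral, G (c r) <= q G r. Together with G r <= ln c * tail Q r + G (c r)
    this gives (1 - q) G r <= ln c * tail Q r, the subtraction of q G r being
    licit because G r is finite. *)
Lemma log_tail_le_tail (R : realType)
    (Q : {measure set (measurableTypeR R) -> \bar R}) (c q r : R) :
  (1 <= c)%R -> (0 <= q)%R -> (q < 1)%R -> (0 < r)%R ->
  (forall x : R, (r <= x)%R -> tail Q x \is a fin_num) ->
  log_tail Q r \is a fin_num ->
  (forall x : R, (r < x)%R -> tail Q (c * x)%R <= q%:E * tail Q x) ->
  log_tail Q r <= (ln c / (1 - q))%:E * tail Q r.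
Proof.
move=> c1 q0 q1 r0 fQ fG dec.
have c0 : (0 < c)%R by rewrite (lt_le_trans ltr01).
have rcr : (r <= c * r)%R by rewrite ler_peMl// ltW.
have Qoo x : (r <= x)%R -> tail Q x < +oo.
  by move=> /fQ; rewrite ge0_fin_numE// tail_ge0.
have contr : log_tail Q (c * r)%R <= q%:E * log_tail Q r.
  apply: log_tail_le_scale; rewrite ?mulr_gt0 ?Qoo// => x x1.
  by rewrite -mulrA dec// ltr_pMr.
have := le_trans (log_tail_le_tail_add c1 r0 (Qoo _ (lexx _))) (leeD2l _ contr).
rewrite -(fineK fG) -(fineK (fQ r (lexx _))) -!EFinM -EFinD !lee_fin => h.
have q1' : (0 < 1 - q)%R by rewrite subr_gt0.
by rewrite mulrAC ler_pdivlMr//; lra.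
Qed.

Theorem lemma1 (R : realType)
    (pi lambda : {measure set (measurableTypeR R) -> \bar R})
    (pi_pos : on_pos pi)
    (pi_neq0 : pi `]0%R, +oo[%classic != 0)
    (pi_moment : moment (-1) pi < +oo)
    (lambda_levy : levy_measure lambda)
    (lambda_log : \int[lambda]_(z in `]1%R, +oo[) (ln z)%:E < +oo)
    (lambda_dom : dominatedly_varying (tail lambda)) :
  let eta := supOU_levy pi lambda in
  [/\ dominatedly_varying (tail eta),
      limsup_pinfty (fun r => tail lambda r / tail eta r) < +oo &
      (exists2 c : R, (1 < c)%R &
         limsup_pinfty (fun r => tail lambda (c * r)%R / tail lambda r) < 1) ->
      limsup_pinfty (fun r => tail eta r / tail lambda r) < +oo].
Proof.
move=> eta; have [fL nzL decL domL] := lambda_dom.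
have posL x : (0 < x)%R -> 0 < tail lambda x.
  by move=> x0; rewrite lt_neqAle eq_sym nzL//= tail_ge0.
have Loo x : (0 < x)%R -> tail lambda x < +oo.
  by move=> x0; rewrite ltey_eq fL.
have two0 : (0 < 2 :> R)%R by rewrite ltr0n.
have m0 : 0 < moment (-1) pi by exact: moment_gt0.
have mf : moment (-1) pi \is a fin_num by rewrite ge0_fin_numE// ltW.
move: (tail_supOU_levy pi lambda) m0; rewrite -(fineK mf) -/eta lte_fin.
move: (fine _) => m etaE m0; clear mf.
(* Finiteness is where the logarithmic moment of lambda is used. *)
have fG x : (0 < x)%R -> log_tail lambda x \is a fin_num.
  by move=> x0; rewrite ge0_fin_numE ?log_tail_ge0// log_tail_lty.
have posG x : (0 < x)%R -> 0 < log_tail lambda x.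
  move=> x0; apply: lt_le_trans (log_tail_ge_dilated_tail (ler1n _ 2) x0 (Loo _ x0)).
  by rewrite mule_gt0 ?posL ?mulr_gt0// lte_fin ln_gt0// ltr1n.
have eta_fin_pos x : (0 < x)%R -> tail eta x \is a fin_num /\ 0 < tail eta x.
  by move=> x0; rewrite etaE// fin_numM ?fG// mule_gt0 ?posG.
have [C [M [C0 _ M0 domM]]] : exists C M : R, [/\ (0 <= C)%R, C%:E < +oo,
    (0 < M)%R &
    forall x : R, (M < x)%R -> tail lambda x <= C%:E * tail lambda (2 * x)%R].
  apply: limsup_ratio_bound domL => // x x0.
  by rewrite fL ?posL ?mulr_gt0.
split.
- split.
  + by move=> x /eta_fin_pos[].
  + by move=> x /eta_fin_pos[_]; rewrite lt_neqAle eq_sym => /andP[].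
  + move=> x y x0 xy; have y0 := lt_le_trans x0 xy.
    rewrite !etaE// lee_wpmul2l ?lee_fin ?(ltW m0)//.
    rewrite -[leRHS]mul1e; apply: log_tail_le_scale; rewrite ?Loo// => t t1.
    have t0 := lt_trans ltr01 t1.
    by rewrite mul1e decL ?mulr_gt0// ler_pM2r.
  + apply: (@limsup_ratio_lty _ _ _ C M) => // [x x0|x Mx].
      by apply: eta_fin_pos; rewrite mulr_gt0.
    have x0 := lt_trans M0 Mx.
    rewrite !etaE ?mulr_gt0// muleCA lee_wpmul2l ?lee_fin ?(ltW m0)//.
    apply: log_tail_le_scale; rewrite ?Loo ?mulr_gt0// => t t1.
    by rewrite -mulrA domM// (lt_trans Mx)// ltr_pMr.
- apply: (@limsup_ratio_lty _ _ _ (C / ln 2 / m) M) => // x Mx.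
  have x0 := lt_trans M0 Mx.
  rewrite etaE// muleA -EFinM divfK ?gt_eqF//.
  by apply: tail_le_log_tail; rewrite ?Loo ?domM.
- move=> [c c1 decc].
  have [q [N [q0 q1 N0 decN]]] : exists q N : R, [/\ (0 <= q)%R, q%:E < 1,
      (0 < N)%R &
      forall x : R, (N < x)%R -> tail lambda (c * x)%R <= q%:E * tail lambda x].
    by apply: limsup_ratio_bound decc => // x x0; rewrite fL ?posL.
  apply: (@limsup_ratio_lty _ _ _ (m * (ln c / (1 - q))) N) => // [x x0|x Nx].
    by rewrite fL ?posL.
  have x0 := lt_trans N0 Nx.
  rewrite etaE// EFinM -muleA lee_wpmul2l ?lee_fin ?(ltW m0)//.
  apply: log_tail_le_tail; rewrite ?(ltW c1) ?fG// => y xy.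
    by rewrite fL// (lt_le_trans x0).
  by rewrite decN// (lt_trans Nx).
Qed.
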